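(* The verification problem for uninterpreted programs that have no nested loops, no conditional branches within loops, and no functions of arity $\ge 2$ in loop bodies can be encoded as the satisfiability problem of $\mathrm{EUF}^n$ formulas: there is an effective procedure which, given such a program $P$, produces an $\mathrm{EUF}^n$ formula $\phi_P$ such that $\phi_P$ is satisfiable if and only if there are a data model $\mathcal{M}$ and an execution of $P$ over $\mathcal{M}$ that reaches the state $\mathit{Fail}$ (so $P$ is correct if and only if $\phi_P$ is unsatisfiable).
   Context: Uninterpreted programs. Over a finite set of program variables and function symbols, statements are $\mathtt{stmt} ::= \mathtt{skip}\mid \mathtt{x:=y}\mid \mathtt{x:=f}(\vec{\mathtt z})\mid \mathtt{assume(cond)}\mid\mathtt{assert(cond)}\mid \mathtt{stmt;stmt}\mid \mathtt{if\,(cond)\,then\,\{stmt\}\,else\,\{stmt\}}\mid\mathtt{while\,(cond)\,\{stmt\}}$, with $\mathtt{cond} ::= \mathtt{x=y}\mid \mathtt{cond}\wedge\mathtt{cond}\mid\neg\mathtt{cond}$, where $\mathtt{x},\mathtt{y}$ are program variables, $\vec{\mathtt z}$ is a tuple of program variables and $\mathtt f$ a function symbol. A data model $\mathcal{M}=(\mathcal{U},\mathcal{I})$ is a set $\mathcal U$ with an interpretation $\mathcal{I}$ of the function symbols on $\mathcal U$; a state maps program variables to elements of $\mathcal U$; the initial values of the variables are unconstrained. Statements have the usual semantics: $\mathtt{assume(c)}$ blocks the execution if $\mathtt c$ is false, and $\mathtt{assert(c)}$ moves to the special state $\mathit{Fail}$ if $\mathtt c$ is false. The verification problem asks whether, for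 every data model $\mathcal M$, no execution of the program over $\mathcal M$ reaches $\mathit{Fail}$. $\mathrm{EUF}^n$ formulas. There is a sort $\mathsf U$ (uninterpreted) and a sort $\mathsf N$ (natural numbers). Terms of sort $\mathsf U$ are $term ::= x\mid f^{lin}(term)\mid g(term,\dots,term)$, with $x$ a variable of sort $\mathsf U$, $f=f_1\circ\cdots\circ f_r$ a finite composition of unary function symbols, $g$ a function symbol of arity $\ge2$, and $lin$ a linear expression with integer coefficients in variables of sort $\mathsf N$ (values required non-negative); $f^k(t)$ means $f$ applied $k$ times to $t$. Formulas are Boolean combinations of equalities between terms. In the encoding of loops, formulas may additionally contain universally quantified index variables $i$ of sort $\mathsf N$, bounded by a loop-count variable $m$ of sort $\mathsf N$ (subformulas of the form $\forall i.\,(i<m\wedge\cdots)\rightarrow\cdots$), linear-arithmetic guards on variables of sort $\mathsf N$, and integer division of such expressions by positive constants. A formula is satisfiable if there are an assignment of natural numbers to its free variables of sort $\mathsf N$, a set $\mathcal U$ with an interpretation of the function symbols, and an assignment of elements of $\mathcal U$ to the variables of sort $\mathsf U$, under which it is true (exponents being read as iterated application). *)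

(* Defs.v *)
From mathcomp Require Import all_boot all_order all_algebra.

Set Implicit Arguments.
Unset Strict Implicit.
Unset Printing Implicit Defensive.

Import Order.TTheory GRing.Theory Num.Theory.

(** * Uninterpreted programs *)

(* Program variables and the names of function symbols are natural numbers; a
   program mentions only finitely many of them.  A function symbol is a name
   together with an arity, the arity being the length of the argument list it
   is applied to (possibly 0). *)
Definition var := nat.
Definition fname := nat.

Inductive cond : Type :=
| CEq of var & var
| CAnd of cond & cond
| CNot of cond.

Inductive stmt : Type :=
| SSkip
| SCopy of var & var                  (* x := y *)
| SApply of var & fname & seq var     (* x := f(z_1, ..., z_n) *)
| SAssume of cond
| SAssert of cond
| SSeq of stmt & stmt
| SIf of cond & stmt & stmt
| SWhile of cond & stmt.

(* [interp f], restricted to the lists of length n, interprets the n-ary symbol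
   named f. *)
Record model := Model {
  univ : Type;
  interp : fname -> seq univ -> univ
}.

Definition upd (T : Type) (s : nat -> T) (x : nat) (u : T) : nat -> T :=
  fun y => if y == x then u else s y.

Section Semantics.
Variable M : model.

Definition state := var -> univ M.

Fixpoint holds (s : state) (c : cond) : Prop :=
  match c with
  | CEq x y => s x = s y
  | CAnd c1 c2 => holds s c1 /\ holds s c2
  | CNot c1 => ~ holds s c1
  end.

Inductive outcome : Type :=
| Done of state
| Fail.

(* [exec P s o]: the execution of P from s terminates with outcome o.  There is
   no rule for an assume whose condition is false: such executions block. *)
Inductive exec : stmt -> state -> outcome -> Prop :=
| ex_skip s : exec SSkip s (Done s)
| ex_copy s x y : exec (SCopy x y) s (Done (upd s x (s y)))
| ex_apply s x f zs :
    exec (SApply x f zs) s (Done (upd s x (interp f (map s zs))))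
| ex_assume s c : holds s c -> exec (SAssume c) s (Done s)
| ex_assert s c : holds s c -> exec (SAssert c) s (Done s)
| ex_assert_fail s c : ~ holds s c -> exec (SAssert c) s Fail
| ex_seq s s' P Q o :
    exec P s (Done s') -> exec Q s' o -> exec (SSeq P Q) s o
| ex_seq_fail s P Q : exec P s Fail -> exec (SSeq P Q) s Fail
| ex_if_true s c P Q o : holds s c -> exec P s o -> exec (SIf c P Q) s o
| ex_if_false s c P Q o : ~ holds s c -> exec Q s o -> exec (SIf c P Q) s o
| ex_while_exit s c P : ~ holds s c -> exec (SWhile c P) s (Done s)
| ex_while_step s s' c P o :
    holds s c -> exec P s (Done s') -> exec (SWhile c P) s' o ->
    exec (SWhile c P) s o
| ex_while_fail s c P :
    holds s c -> exec P s Fail -> exec (SWhile c P) s Fail.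

End Semantics.

Definition reaches_fail (P : stmt) : Prop :=
  exists (M : model) (s : state M), exec P s (Fail M).

Definition correct (P : stmt) : Prop :=
  forall (M : model) (s : state M), ~ exec P s (Fail M).

Fixpoint simple_body (P : stmt) : bool :=
  match P with
  | SSkip | SCopy _ _ | SAssume _ | SAssert _ => true
  | SApply _ _ zs => size zs <= 1
  | SSeq P1 P2 => simple_body P1 && simple_body P2
  | SIf _ _ _ | SWhile _ _ => false
  end.

(* No nested loops, and in loop bodies no conditional branches and no functions
   of arity at least 2. *)
Fixpoint simple_loops (P : stmt) : bool :=
  match P with
  | SSkip | SCopy _ _ | SApply _ _ _ | SAssume _ | SAssert _ => true
  | SSeq P1 P2 | SIf _ P1 P2 => simple_loops P1 && simple_loops P2
  | SWhile _ P1 => simple_body P1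
  end.

(** * EUF^n formulas *)

(* Linear expressions over variables of sort N, with integer division by
   positive constants: [ADiv a d] is the floor of a / (d + 1). *)
Inductive arith : Type :=
| AConst of int
| AVar of nat
| AAdd of arith & arith
| AScale of int & arith
| ADiv of arith & nat.

Inductive term : Type :=
| TVar of nat
  (* [TIter f fs a t] is (f o f_1 o ... o f_r)^a (t), where fs = f_1, ..., f_r *)
| TIter of fname & seq fname & arith & term
  (* [TApp g t1 t2 ts] is g(t1, t2, ts): arity at least 2 *)
| TApp of fname & term & term & seq term.

Inductive qform : Type :=
| QEq of term & term
| QLe of arith & arith
| QNot of qform
| QAnd of qform & qform
| QOr of qform & qform.

(* [FAll i m q] is "forall i : N, i < m -> q".  Guards on i are written inside
   q.  Index quantifiers are not nested and occur positively only, so that they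
   are indeed universal and m is a free variable of the formula. *)
Inductive formula : Type :=
| FQf of qform
| FAnd of formula & formula
| FOr of formula & formula
| FAll of nat & nat & qform.

Fixpoint aeval (nu : nat -> nat) (a : arith) : int :=
  match a with
  | AConst z => z
  | AVar n => (nu n)%:Z
  | AAdd a1 a2 => (aeval nu a1 + aeval nu a2)%R
  | AScale k a1 => (k * aeval nu a1)%R
  | ADiv a1 d => (aeval nu a1 %/ d.+1%:Z)%Z
  end.

Fixpoint defined (nu : nat -> nat) (t : term) : bool :=
  match t with
  | TVar _ => true
  | TIter _ _ a t1 => (0 <= aeval nu a)%R && defined nu t1
  | TApp _ t1 t2 ts => [&& defined nu t1, defined nu t2 & all (defined nu) ts]
  end.

Section Satisfaction.
Variables (M : model) (rho : nat -> univ M).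

Definition compose (fs : seq fname) (u : univ M) : univ M :=
  foldr (fun f v => interp f [:: v]) u fs.

(* The absolute value only makes the function total: [teval] is used on terms
   whose exponents are non-negative. *)
Fixpoint teval (nu : nat -> nat) (t : term) : univ M :=
  match t with
  | TVar x => rho x
  | TIter f fs a t1 => iter `|aeval nu a|%N (compose (f :: fs)) (teval nu t1)
  | TApp g t1 t2 ts =>
      interp g [:: teval nu t1, teval nu t2 & map (teval nu) ts]
  end.

(* [qsat nu true q]: q is true; [qsat nu false q]: q is false.  An equality in
   which some exponent is negative is neither true nor false, and the
   connectives are those of Kleene's strong three-valued logic.  Hence
   non-negativity is required of every exponent that the truth of the formula
   relies on, but not of those under a guard that does not hold. *)
Fixpoint qsat (nu : nat -> nat) (b : bool) (q : qform) : Prop :=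
  match q with
  | QEq t1 t2 =>
      [/\ defined nu t1, defined nu t2 &
          if b then teval nu t1 = teval nu t2 else teval nu t1 <> teval nu t2]
  | QLe a1 a2 => (aeval nu a1 <= aeval nu a2)%R = b
  | QNot q1 => qsat nu (~~ b) q1
  | QAnd q1 q2 =>
      if b then qsat nu b q1 /\ qsat nu b q2 else qsat nu b q1 \/ qsat nu b q2
  | QOr q1 q2 =>
      if b then qsat nu b q1 \/ qsat nu b q2 else qsat nu b q1 /\ qsat nu b q2
  end.

Fixpoint fsat (nu : nat -> nat) (phi : formula) : Prop :=
  match phi with
  | FQf q => qsat nu true q
  | FAnd phi1 phi2 => fsat nu phi1 /\ fsat nu phi2
  | FOr phi1 phi2 => fsat nu phi1 \/ fsat nu phi2
  | FAll i m q => forall k : nat, k < nu m -> qsat (upd nu i k) true q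
  end.

End Satisfaction.

Definition satisfiable (phi : formula) : Prop :=
  exists (nu : nat -> nat) (M : model) (rho : nat -> univ M), fsat rho nu phi.

(** * Effective procedures *)

(* Programs and formulas are coded by binary trees. *)
Inductive tree : Type :=
| Leaf
| Node of tree & tree.

Definition lchild (x : tree) : tree := if x is Node l _ then l else Leaf.
Definition rchild (x : tree) : tree := if x is Node _ r then r else Leaf.

(* Structural recursion on x with parameter a; the step function receives
   ((a, (l, r)), (value at l, value at r)). *)
Fixpoint treerec (f g : tree -> tree) (a x : tree) : tree :=
  match x with
  | Leaf => f a
  | Node l r =>
      g (Node (Node a (Node l r)) (Node (treerec f g a l) (treerec f g a r)))
  end.

(* The total recursive functions on trees: the least class that contains the
   basic tree operations and is closed under composition, structural recursion
   and terminating while-loops "while c(x) <> Leaf do x := f(x)".  Membership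
   is meant up to pointwise equality ([rec_ext]). *)
Inductive recursive : (tree -> tree) -> Prop :=
| rec_id : recursive (fun x => x)
| rec_leaf : recursive (fun _ => Leaf)
| rec_lchild : recursive lchild
| rec_rchild : recursive rchild
| rec_node f g :
    recursive f -> recursive g -> recursive (fun x => Node (f x) (g x))
| rec_comp f g : recursive f -> recursive g -> recursive (fun x => f (g x))
| rec_treerec f g :
    recursive f -> recursive g ->
    recursive (fun x => treerec f g (lchild x) (rchild x))
| rec_while c f h :
    recursive c -> recursive f ->
    (forall x, exists n : nat,
       [/\ h x = iter n f x, c (iter n f x) = Leaf &
           forall k, k < n -> c (iter k f x) <> Leaf]) ->
    recursive h
| rec_ext f g : recursive f -> f =1 g -> recursive g.

Fixpoint nat_tree (n : nat) : tree :=
  if n is n'.+1 then Node Leaf (nat_tree n') else Leaf.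

Definition int_tree (z : int) : tree :=
  match z with
  | Posz n => Node Leaf (nat_tree n)
  | Negz n => Node (Node Leaf Leaf) (nat_tree n)
  end.

Definition seq_tree (ts : seq tree) : tree := foldr Node Leaf ts.

(* The code of a syntax node: a tag for its constructor, then the list of the
   codes of its arguments. *)
Definition con (k : nat) (args : seq tree) : tree :=
  Node (nat_tree k) (seq_tree args).

Fixpoint cond_tree (c : cond) : tree :=
  match c with
  | CEq x y => con 0 [:: nat_tree x; nat_tree y]
  | CAnd c1 c2 => con 1 [:: cond_tree c1; cond_tree c2]
  | CNot c1 => con 2 [:: cond_tree c1]
  end.

Fixpoint stmt_tree (P : stmt) : tree :=
  match P with
  | SSkip => con 0 [::]
  | SCopy x y => con 1 [:: nat_tree x; nat_tree y]
  | SApply x f zs =>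
      con 2 [:: nat_tree x; nat_tree f; seq_tree (map nat_tree zs)]
  | SAssume c => con 3 [:: cond_tree c]
  | SAssert c => con 4 [:: cond_tree c]
  | SSeq P1 P2 => con 5 [:: stmt_tree P1; stmt_tree P2]
  | SIf c P1 P2 => con 6 [:: cond_tree c; stmt_tree P1; stmt_tree P2]
  | SWhile c P1 => con 7 [:: cond_tree c; stmt_tree P1]
  end.

Fixpoint arith_tree (a : arith) : tree :=
  match a with
  | AConst z => con 0 [:: int_tree z]
  | AVar n => con 1 [:: nat_tree n]
  | AAdd a1 a2 => con 2 [:: arith_tree a1; arith_tree a2]
  | AScale k a1 => con 3 [:: int_tree k; arith_tree a1]
  | ADiv a1 d => con 4 [:: arith_tree a1; nat_tree d]
  end.

Fixpoint term_tree (t : term) : tree :=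
  match t with
  | TVar x => con 0 [:: nat_tree x]
  | TIter f fs a t1 =>
      con 1 [:: nat_tree f; seq_tree (map nat_tree fs); arith_tree a;
                term_tree t1]
  | TApp g t1 t2 ts =>
      con 2 [:: nat_tree g; term_tree t1; term_tree t2;
                seq_tree (map term_tree ts)]
  end.

Fixpoint qform_tree (q : qform) : tree :=
  match q with
  | QEq t1 t2 => con 0 [:: term_tree t1; term_tree t2]
  | QLe a1 a2 => con 1 [:: arith_tree a1; arith_tree a2]
  | QNot q1 => con 2 [:: qform_tree q1]
  | QAnd q1 q2 => con 3 [:: qform_tree q1; qform_tree q2]
  | QOr q1 q2 => con 4 [:: qform_tree q1; qform_tree q2]
  end.

Fixpoint formula_tree (phi : formula) : tree :=
  match phi with
  | FQf q => con 0 [:: qform_tree q]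
  | FAnd phi1 phi2 => con 1 [:: formula_tree phi1; formula_tree phi2]
  | FOr phi1 phi2 => con 2 [:: formula_tree phi1; formula_tree phi2]
  | FAll i m q => con 3 [:: nat_tree i; nat_tree m; qform_tree q]
  end.

Definition effective (enc : stmt -> formula) : Prop :=
  exists2 h : tree -> tree,
    recursive h & forall P : stmt, h (stmt_tree P) = formula_tree (enc P).

(* Main.v *)
(* An execution of P is described by elements of the universe. A state s is an
   element; the value of x in s, the outcome of a program from s and the i-th
   state of a loop started in s are values of auxiliary functions at s and at
   terms that name x, P and i. The formula states, by recursion on P, the
   relation between a state and the outcome of P from it. For a loop this is one
   condition on the states i and i+1, for every i below a bound m; since a step
   may also leave the state unchanged, the same m serves for all loops, and the
   whole formula needs a single index quantifier. As loops are not nested, one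
   index is enough.

   A solution of the formula yields an execution because outcomes satisfy the
   stated relations. Conversely, an execution over M yields a solution over the
   disjoint union of M, the outcomes over M and the codes of programs:
   executions are deterministic and programs are determined by their codes, so
   the auxiliary functions are well defined. *)
Require Import Defs.
From mathcomp Require Import all_boot all_algebra zify.
From Stdlib Require Import Classical ClassicalEpsilon FunctionalExtensionality.

Set Implicit Arguments.
Unset Strict Implicit.
Unset Printing Implicit Defensive.

(** * Closure properties of the recursive functions *)

Fixpoint tree_size (x : tree) : nat :=
  if x is Node l r then (tree_size l + tree_size r).+1 else 0.

Definition ite (c x y : tree) : tree := if c is Leaf then x else y.

Lemma rec_const t : recursive (fun _ => t).
Proof. by elim: t => [|l Hl r Hr]; [exact: rec_leaf | exact: rec_node]. Qed.

Lemma rec_lchild_comp f : recursive f -> recursive (fun x => lchild (f x)).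
Proof. exact: rec_comp rec_lchild. Qed.

Lemma rec_rchild_comp f : recursive f -> recursive (fun x => rchild (f x)).
Proof. exact: rec_comp rec_rchild. Qed.

Lemma rec_treerec_comp f g a x :
  recursive f -> recursive g -> recursive a -> recursive x ->
  recursive (fun z => treerec f g (a z) (x z)).
Proof.
by move=> Hf Hg Ha Hx; apply: (rec_comp (rec_treerec Hf Hg) (rec_node Ha Hx)).
Qed.

Lemma rec_ite c x y : recursive c -> recursive x -> recursive y ->
  recursive (fun z => ite (c z) (x z) (y z)).
Proof.
move=> Hc Hx Hy.
(* A case distinction is a structural recursion on the condition that ignores the recursive values.
   The step function finds the parameter at [lchild (lchild w)]. *)
apply: (@rec_ext (fun z => treerec x (fun w => y (lchild (lchild w))) z (c z))).
  apply: rec_treerec_comp => //; last exact: rec_id.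
  by apply: rec_comp Hy _; do 2!apply: rec_lchild_comp; exact: rec_id.
by move=> z /=; case: (c z).
Qed.

Ltac rec_tac :=
  repeat first
    [ exact: rec_id | exact: rec_const | assumption
    | match goal with
      | H : recursive ?F |- recursive (fun z => ?F _) => apply: (rec_comp H)
      end
    | apply: rec_node | apply: rec_lchild_comp | apply: rec_rchild_comp
    | apply: rec_ite | apply: rec_treerec_comp ].

(** [rec_while] asks for the least halting count. Since [f] fixes the halted configurations, every
    halting count gives the same result, and any one of them may be supplied. *)
Lemma rec_fixpoint c f :
  recursive c -> recursive f ->
  (forall x, c x = Leaf -> f x = x) ->
  (forall x, exists n, c (iter n f x) = Leaf) ->
  exists2 h, recursive h &
    forall x n, c (iter n f x) = Leaf -> h x = iter n f x.
Proof.
move=> Hc Hf fix_f term.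
pose is_leaf t := if t is Leaf then true else false.
have leafP t : reflect (t = Leaf) (is_leaf t) by case: t => *; constructor.
have term' x : exists n, is_leaf (c (iter n f x)).
  by have [n /leafP Hn] := term x; exists n.
exists (fun x => iter (ex_minn (term' x)) f x).
  apply: (rec_while Hc Hf) => x; exists (ex_minn (term' x)).
  case: ex_minnP => n /leafP Hn min_n; split=> // k lt_kn Hk.
  by have := min_n k; rewrite leqNgt lt_kn Hk => /(_ isT).
move=> x n Hn; case: ex_minnP => m /leafP Hm /(_ n).
rewrite Hn => /(_ isT) /subnK <-; elim: (n - m) => //= k <-.
by rewrite fix_f.
Qed.

(** * Recursion with two calls on changed arguments *)

Section DivideAndConquer.
Variables (p b d1 d2 g : tree -> tree) (mu : tree -> nat).
Hypotheses (Hp : recursive p) (Hb : recursive b) (Hd1 : recursive d1).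
Hypotheses (Hd2 : recursive d2) (Hg : recursive g).
Hypothesis dec1 : forall z, p z <> Leaf -> mu (d1 z) < mu z.
Hypothesis dec2 : forall z, p z <> Leaf -> mu (d2 z) < mu z.

(** [treerec] hands the same parameter to both subtrees, whereas the encoding changes the state term
    on its way down: the second part of a sequence gets the outcome of the first. Here the calls may
    change the whole argument, as long as the measure [mu] decreases. *)
Fixpoint dc_fuel n z :=
  if n is n'.+1 then
    ite (p z) (b z)
      (g (Node z (Node (dc_fuel n' (d1 z)) (dc_fuel n' (d2 z)))))
  else Leaf.

Definition dc z := dc_fuel (mu z).+1 z.

(** Any fuel above [mu z] gives the same value, because both calls lower [mu]. *)
Lemma dcE z :
  dc z = ite (p z) (b z) (g (Node z (Node (dc (d1 z)) (dc (d2 z))))).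
Proof.
have fuelE n m x : mu x < n -> mu x < m -> dc_fuel n x = dc_fuel m x.
  elim: n m x => // n IHn [//|m] x lt_xn lt_xm /=.
  case Epx: (p x) => [|l r] //=.
  have npx : p x <> Leaf by rewrite Epx.
  by rewrite (IHn m (d1 x)) ?(IHn m (d2 x)) //;
    apply: leq_trans (_ : mu x <= _); rewrite ?dec1 ?dec2.
rewrite {1}/dc /=; case Epz: (p z) => [|l r] //=.
have npz : p z <> Leaf by rewrite Epz.
by rewrite (fuelE _ (mu (d1 z)).+1 (d1 z)) ?(fuelE _ (mu (d2 z)).+1 (d2 z))
  ?dec1 ?dec2.
Qed.

(* A stack machine: a configuration is a stack of tasks and a stack of results;
   a task [Node (Node _ _) z] evaluates z, the others combine two results. *)
Definition dc_step (w : tree) : tree :=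
  let task := lchild (lchild w) in
  let z := rchild task in
  let rest := rchild (lchild w) in
  let vs := rchild w in
  let eval z' := Node (Node Leaf Leaf) z' in
  ite (lchild w) w
    (ite (lchild task)
       (Node rest (Node (g (Node z (Node (lchild (rchild vs)) (lchild vs))))
                        (rchild (rchild vs))))
       (ite (p z) (Node rest (Node (b z) vs))
          (Node (Node (eval (d1 z)) (Node (eval (d2 z))
                   (Node (Node Leaf z) rest))) vs))).

Let reach w w' := exists n, iter n dc_step w = w'.

Let reach_trans w2 w1 w3 : reach w1 w2 -> reach w2 w3 -> reach w1 w3.
Proof. by case=> n <- [m <-]; exists (m + n); rewrite iterD. Qed.

(** Induction on a bound for [mu z]. The call on [d2 z] finishes last, so its result lies on top of
    that of [d1 z]; the combining task restores the order. *)
Lemma dc_reach t1 t2 z rest vs :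
  reach (Node (Node (Node (Node t1 t2) z) rest) vs)
        (Node rest (Node (dc z) vs)).
Proof.
move: {2}_.+1 (ltnSn (mu z)) => n.
elim: n t1 t2 z rest vs => // n IHn t1 t2 z rest vs le_zn.
rewrite dcE; case Epz: (p z) => [|l r] /=.
  by exists 1; rewrite /dc_step /= Epz.
have npz : p z <> Leaf by rewrite Epz.
apply: reach_trans; first by exists 1; rewrite /dc_step /= Epz.
apply: reach_trans; first by apply: IHn; apply: leq_trans (dec1 npz) le_zn.
apply: reach_trans; first by apply: IHn; apply: leq_trans (dec2 npz) le_zn.
by exists 1.
Qed.

Lemma rec_dc : recursive dc.
Proof.
have Hstep : recursive dc_step by rewrite /dc_step; rec_tac.
have [|w|h Hh hE] := rec_fixpoint rec_lchild Hstep; first by case=> [|[|l r] v].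
  (* Termination is required from every tree, including ill-formed configurations: by induction on
     the stack of tasks, each task is used up after finitely many steps. *)
  case: w => [|work vs]; first by exists 0.
  elim: work vs => [|task _ rest IHrest] vs; first by exists 0.
  have [vs' [n Hn]] :
      exists vs', reach (Node (Node task rest) vs) (Node rest vs').
    case: task => [|[|t1 t2] z]; try by eexists; exists 1.
    by exists (Node (dc z) vs); apply: dc_reach.
  by have [m Hm] := IHrest vs'; exists (m + n); rewrite iterD Hn.
pose init z := Node (Node (Node (Node Leaf Leaf) z) Leaf) Leaf.
apply: (@rec_ext (fun z => lchild (rchild (h (init z))))).
  by rec_tac.
move=> z; have [n Hn] := dc_reach Leaf Leaf z Leaf Leaf.
by rewrite (hE _ n) Hn.
Qed.

End DivideAndConquer.

(** * The encoding *)

(* In the formula, function 0 and the variables 0, 1, 2 are auxiliary; a program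
   symbol f becomes f.+1, or the variable f.+3 if it is nullary. *)
Definition origin := TVar 0.
Definition failed := TVar 1.
Definition start := TVar 2.
Definition bound_var := 0.
Definition index_var := 1.

(** The arity separates the uses of function 0: unary it is a successor, turning numbers into
    elements; binary it pairs codes and gives outcomes; ternary it gives values of variables; with
    four arguments it gives loop states. A final [origin] only raises the arity. *)
Definition idx (a : arith) : term := TIter 0 [::] a origin.
Definition num (n : nat) : term := idx (AConst n).

Fixpoint quote (t : tree) : term :=
  if t is Node l r then TApp 0 (quote l) (quote r) [::] else origin.

Definition value (S : term) (x : nat) : term := TApp 0 S (num x) [:: origin].
Definition out (P : stmt) (S : term) : term :=
  TApp 0 S (quote (stmt_tree P)) [::].
(* The state after a steps of the loop P started in S. *)
Definition loop_state (P : stmt) (S : term) (a : arith) : term :=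
  TApp 0 S (quote (stmt_tree P)) [:: idx a; origin].

Definition apply_term (S : term) (f : fname) (zs : seq var) : term :=
  match zs with
  | [::] => TVar f.+3
  | [:: z] => TIter f.+1 [::] (AConst 1) (value S z)
  | z1 :: z2 :: zs' => TApp f.+1 (value S z1) (value S z2) (map (value S) zs')
  end.

(** The test whether [z] is [x] is left to the formula, as two inequalities between constants, so
    that the encoder need not compare numbers. *)
Fixpoint frame (n : nat) (S O : term) (x : var) : qform :=
  if n is z.+1 then
    QAnd (QOr (QAnd (QLe (AConst z) (AConst x)) (QLe (AConst x) (AConst z)))
              (QEq (value O z) (value S z)))
         (frame z S O x)
  else QLe (AConst 0) (AConst 0).

Definition assign (n : nat) (S O : term) (x : var) (t : term) : qform :=
  QAnd (QNot (QEq O failed)) (QAnd (QEq (value O x) t) (frame n S O x)).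

Fixpoint enc_cond (c : cond) (S : term) : qform :=
  match c with
  | CEq x y => QEq (value S x) (value S y)
  | CAnd c1 c2 => QAnd (enc_cond c1 S) (enc_cond c2 S)
  | CNot c1 => QNot (enc_cond c1 S)
  end.

Definition unless_failed (S O : term) (q : qform) : qform :=
  QOr (QAnd (QEq S failed) (QEq O failed)) (QAnd (QNot (QEq S failed)) q).

(* A step of a loop may also leave the state unchanged: the constraints then
   hold for a common bound on the numbers of iterations of all the loops. *)
Fixpoint enc_stmt (n : nat) (P : stmt) (S : term) : qform :=
  unless_failed S (out P S)
    match P with
    | SSkip => QEq (out P S) S
    | SCopy x y => assign n S (out P S) x (value S y)
    | SApply x f zs => assign n S (out P S) x (apply_term S f zs)
    | SAssume c => QAnd (enc_cond c S) (QEq (out P S) S)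
    | SAssert c =>
        QOr (QAnd (enc_cond c S) (QEq (out P S) S))
            (QAnd (QNot (enc_cond c S)) (QEq (out P S) failed))
    | SSeq P1 P2 =>
        QAnd (QAnd (enc_stmt n P1 S) (enc_stmt n P2 (out P1 S)))
             (QEq (out P S) (out P2 (out P1 S)))
    | SIf c P1 P2 =>
        QOr (QAnd (enc_cond c S)
                  (QAnd (enc_stmt n P1 S) (QEq (out P S) (out P1 S))))
            (QAnd (QNot (enc_cond c S))
                  (QAnd (enc_stmt n P2 S) (QEq (out P S) (out P2 S))))
    | SWhile c P1 =>
        let Si := loop_state P S (AVar index_var) in
        let Si1 := loop_state P S (AAdd (AVar index_var) (AConst 1)) in
        let Sm := loop_state P S (AVar bound_var) in
        QAnd (QAnd (QEq (loop_state P S (AConst 0)) S) (QEq (out P S) Sm))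
          (QAnd (QOr (QEq Sm failed) (QNot (enc_cond c Sm)))
             (QOr (QEq Si1 Si)
                (QAnd (enc_cond c Si)
                   (QAnd (enc_stmt n P1 Si) (QEq Si1 (out P1 Si))))))
    end.

(** Even the constraints that do not mention the index stand under the quantifier; a bound of at
    least 1 keeps them from being vacuous. The size of the code exceeds all variables of [P], as
    numbers are coded in unary. *)
Definition enc (P : stmt) : formula :=
  FAnd (FQf (QAnd (QLe (AConst 1) (AVar bound_var))
               (QAnd (QNot (QEq start failed)) (QEq (out P start) failed))))
       (FAll index_var bound_var (enc_stmt (tree_size (stmt_tree P)) P start)).

(** * Bounds on the program variables *)

Fixpoint cond_below (n : nat) (c : cond) : bool :=
  match c with
  | CEq x y => (x < n) && (y < n)
  | CAnd c1 c2 => cond_below n c1 && cond_below n c2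
  | CNot c1 => cond_below n c1
  end.

Fixpoint stmt_below (n : nat) (P : stmt) : bool :=
  match P with
  | SSkip => true
  | SCopy x y => (x < n) && (y < n)
  | SApply x _ zs => (x < n) && all (fun z => z < n) zs
  | SAssume c | SAssert c => cond_below n c
  | SSeq P1 P2 => stmt_below n P1 && stmt_below n P2
  | SIf c P1 P2 => [&& cond_below n c, stmt_below n P1 & stmt_below n P2]
  | SWhile c P1 => cond_below n c && stmt_below n P1
  end.

Lemma tree_size_nat_tree n : tree_size (nat_tree n) = n.
Proof. by elim: n => //= n ->. Qed.

Lemma cond_below_tree_size n c : tree_size (cond_tree c) <= n -> cond_below n c.
Proof.
elim: c n => [x y|c1 IH1 c2 IH2|c1 IH1] n /=;
  rewrite ?tree_size_nat_tree => le_n.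
- by apply/andP; split; lia.
- by rewrite IH1 ?IH2 //; lia.
- by rewrite IH1 //; lia.
Qed.

Lemma stmt_below_tree_size n P : tree_size (stmt_tree P) <= n -> stmt_below n P.
Proof.
elim: P n => [|x y|x f zs|c|c|P1 IH1 P2 IH2|c P1 IH1 P2 IH2|c P1 IH1] n /=;
  rewrite ?tree_size_nat_tree => le_n //; do ?[apply/andP; split];
  try by [ lia | apply: cond_below_tree_size; lia
         | apply: IH1; lia | apply: IH2; lia ].
have {le_n}: tree_size (seq_tree (map nat_tree zs)) <= n by lia.
elim: zs => //= z zs IHzs; rewrite tree_size_nat_tree => le_n.
by rewrite IHzs; lia.
Qed.

(** * Evaluation of the auxiliary terms and formulas *)

Section Evaluation.
Variables (M : model) (rho : nat -> univ M).
Implicit Types (nu : nat -> nat) (S O : term).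

Lemma teval_quote nu nu' t : teval rho nu (quote t) = teval rho nu' (quote t).
Proof. by elim: t => //= l -> r ->. Qed.

Lemma defined_quote nu t : defined nu (quote t).
Proof. by elim: t => //= l -> r ->. Qed.

Lemma defined_out nu P S : defined nu (out P S) = defined nu S.
Proof. by rewrite /out /= defined_quote !andbT. Qed.

Lemma defined_loop_state nu P S a :
  defined nu (loop_state P S a) = defined nu S && (0 <= aeval nu a)%R.
Proof. by rewrite /= defined_quote !andbT. Qed.

Lemma defined_value nu S x : defined nu (value S x) = defined nu S.
Proof. by rewrite /value /= !andbT. Qed.

Lemma teval_value nu S x :
  teval rho nu (value S x) =
    interp 0 [:: teval rho nu S; teval rho nu (num x); rho 0].
Proof. by []. Qed.

Lemma teval_out nu P S :
  teval rho nu (out P S) =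
    interp 0 [:: teval rho nu S; teval rho nu (quote (stmt_tree P))].
Proof. by []. Qed.

Lemma teval_loop_state nu P S a :
  teval rho nu (loop_state P S a) =
    interp 0 [:: teval rho nu S; teval rho nu (quote (stmt_tree P));
                 teval rho nu (idx a); rho 0].
Proof. by []. Qed.

Opaque value out loop_state.

Lemma defined_apply_term nu S f zs :
  defined nu S -> defined nu (apply_term S f zs).
Proof.
move=> dS; case: zs => [|z1 [|z2 zs]] //=; rewrite !defined_value !dS //=.
by elim: zs => //= z zs ->; rewrite defined_value dS.
Qed.

Lemma qsat_frame nu n S O x : defined nu S -> defined nu O ->
  qsat rho nu true (frame n S O x) <->
  forall z, z < n -> z <> x ->
    teval rho nu (value O z) = teval rho nu (value S z).
Proof.
move=> dS dO; elim: n => [|n IHn]; first by split.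
have le_int (a b : nat) : (Posz a <= Posz b)%R = true <-> a <= b by [].
split.
  move=> [Hn /IHn Hz] z; rewrite ltnS leq_eqVlt.
  move=> /orP[/eqP-> ne|]; last exact: Hz.
  case: Hn => [[H1 H2]|[_ _ //]]; case: ne; apply/eqP.
  by rewrite eqn_leq; apply/andP; split; [exact: H1 | exact: H2].
move=> Hz; split; last by apply/IHn => z lt_zn; apply: Hz; rewrite ltnW.
have [->|/eqP ne] := eqVneq n x; first by left; split; exact: leqnn.
by right; split; rewrite ?defined_value //; apply: Hz.
Qed.

(** The injection [f] lets one lemma serve both directions: it is the identity for soundness and
    [EVal] for completeness. *)
Lemma qsat_enc_cond (M0 : model) (f : univ M0 -> univ M) (s : state M0)
    nu n b c S :
  injective f -> defined nu S ->
  (forall x, x < n -> teval rho nu (value S x) = f (s x)) -> cond_below n c ->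
  qsat rho nu b (enc_cond c S) <-> if b then holds s c else ~ holds s c.
Proof.
move=> inj_f dS vS; elim: c b => [x y|c1 IH1 c2 IH2|c1 IH1] b.
- case/andP=> lt_x lt_y.
  rewrite [qsat _ _ _ _]/= -/(value S x) -/(value S y) !defined_value.
  by rewrite !vS //; case: b; split=> [[_ _]|] /=;
     [exact: inj_f|move->|move=> ne eq; apply: ne; rewrite eq
     |move=> ne; split=> // /inj_f].
- case/andP=> /IH1 {}IH1 /IH2 {}IH2.
  by case: b => /=; rewrite IH1 IH2 //; tauto.
- by move=> /IH1 {}IH1 /=; rewrite IH1; case: b => /=; tauto.
Qed.

Lemma qsat_neq nu S O : defined nu S -> defined nu O ->
  qsat rho nu true (QNot (QEq S O)) <-> teval rho nu S <> teval rho nu O.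
Proof. by move=> dS dO; split=> [[]|]. Qed.

End Evaluation.

Opaque value out loop_state.

(** * Soundness *)

Lemma qsat_unless_failed (M : model) (rho : nat -> univ M) nu S O q :
  defined nu S -> defined nu O ->
  qsat rho nu true (unless_failed S O q) <->
  teval rho nu S = rho 1 /\ teval rho nu O = rho 1 \/
  teval rho nu S <> rho 1 /\ qsat rho nu true q.
Proof.
move=> dS dO; split=> /=.
  by case=> [[[_ _ ->] [_ _ ->]]|[[_ _ ?] ?]]; auto.
by case=> [[-> ->]|[? ?]]; [left|right].
Qed.

Section Soundness.
Variables (M : model) (rho : nat -> univ M) (nu : nat -> nat) (n : nat).

Let nui (i : nat) : nat -> nat := upd nu index_var i.
Let ev (i : nat) (t : term) : univ M := teval rho (nui i) t.

Definition decode_model : model :=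
  Model (fun f args => if args is [::] then rho f.+3 else interp f.+1 args).

(* Only variables below n are read, so that the frame conditions suffice for
   equality of states as functions. *)
Definition decode_state (u : univ M) : state decode_model :=
  fun x => if x < n then interp 0 [:: u; teval rho nu (num x); rho 0]
           else rho 0.

Definition decode_outcome (u : univ M) : outcome decode_model :=
  if excluded_middle_informative (u = rho 1) then Fail decode_model
  else Done (decode_state u).

Definition runs (P : stmt) (u v : univ M) : Prop :=
  (u = rho 1 -> v = rho 1) /\
  (u <> rho 1 -> exec P (decode_state u) (decode_outcome v)).

Lemma decode_done u : u <> rho 1 -> decode_outcome u = Done (decode_state u).
Proof. by rewrite /decode_outcome; case: excluded_middle_informative. Qed.

Lemma decode_fail u : u = rho 1 -> decode_outcome u = Fail decode_model.
Proof. by rewrite /decode_outcome; case: excluded_middle_informative. Qed.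

Lemma teval_value_decode i S x :
  x < n -> ev i (value S x) = decode_state (ev i S) x.
Proof. by rewrite /decode_state => ->. Qed.

Lemma holds_decode i b c S : cond_below n c -> defined (nui i) S ->
  qsat rho (nui i) b (enc_cond c S) <->
  if b then holds (decode_state (ev i S)) c
  else ~ holds (decode_state (ev i S)) c.
Proof.
move=> lt_c dS.
apply: (@qsat_enc_cond M rho decode_model (fun u => u) _ _ n) lt_c => // x lt_x.
exact: teval_value_decode.
Qed.

Lemma assign_decode i S O x t : x < n ->
  defined (nui i) S -> defined (nui i) O -> defined (nui i) t ->
  qsat rho (nui i) true (assign n S O x t) ->
  decode_outcome (ev i O) =
    Done (upd (decode_state (ev i S)) x (ev i t) : state decode_model).
Proof.
move=> lt_x dS dO dt [/qsat_neq neq [[_ _ eq_x] /qsat_frame frameO]].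
rewrite decode_done; last exact: neq.
congr Done; apply: functional_extensionality => y; rewrite /upd.
case: eqP => [->|/eqP ne_yx].
  by rewrite -teval_value_decode.
rewrite {1}/decode_state; case: ltnP => [lt_y|ge_y].
  rewrite -teval_value_decode //; apply: frameO => //; exact/eqP.
by rewrite /decode_state ltnNge ge_y.
Qed.

Lemma apply_term_decode i S f zs : all (fun z => z < n) zs ->
  ev i (apply_term S f zs) =
    @interp decode_model f (map (decode_state (ev i S)) zs).
Proof.
rewrite /ev; case: zs => [//|z1 [|z2 zs]] /=.
  by rewrite andbT => lt_z1; rewrite -teval_value_decode.
case/and3P=> lt_z1 lt_z2 lt_zs; rewrite -!teval_value_decode //.
congr (interp _ [:: _, _ & _]).
elim: zs lt_zs => //= z zs IHzs /andP[lt_z lt_zs].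
by rewrite -teval_value_decode // IHzs.
Qed.

(** The common first step of all cases of the next lemma. [J] is a set of indices at which the
    constraint is known. As [S] has one value on [J], its not having failed at [j] removes the guard
    at all these indices. *)
Lemma runs_unless_failed P S (J : nat -> Prop) j q : J j ->
  (forall i, J i -> ev i S = ev j S) -> (forall i, defined (nui i) S) ->
  (forall i, J i -> qsat rho (nui i) true (unless_failed S (out P S) q)) ->
  (ev j S <> rho 1 -> (forall i, J i -> qsat rho (nui i) true q) ->
     exec P (decode_state (ev j S)) (decode_outcome (ev j (out P S)))) ->
  runs P (ev j S) (ev j (out P S)).
Proof.
move=> Jj evS dS sat exec_q.
have {}sat i : J i -> ev i S = rho 1 /\ ev i (out P S) = rho 1 \/
    ev i S <> rho 1 /\ qsat rho (nui i) true q.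
  by move=> Ji; apply/qsat_unless_failed; rewrite ?defined_out //; apply: sat.
split=> [E|ne]; first by case: (sat j Jj) => [[]|[]].
by apply: exec_q => // i Ji; case: (sat i Ji) => [[]|[]]; rewrite evS.
Qed.

(* Inside a loop, the constraints of a statement are only known for the current
   iteration; outside, for all of them. *)
Lemma runs_enc_stmt P S (J : nat -> Prop) j :
  stmt_below n P -> J j ->
  simple_body P \/ simple_loops P /\ (forall i, i < nu bound_var -> J i) ->
  (forall i, J i -> ev i S = ev j S) -> (forall i, defined (nui i) S) ->
  (forall i, J i -> qsat rho (nui i) true (enc_stmt n P S)) ->
  runs P (ev j S) (ev j (out P S)).
Proof.
elim: P S J j => [|x y|x f zs|c|c|P1 IH1 P2 IH2|c P1 IH1 P2 IH2|c P1 IH1] S J j;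
  move=> lt_P Jj simpleP evS dS sat;
  apply: (runs_unless_failed Jj evS dS sat) => ne {}sat;
  have dO i Q : defined (nui i) (out Q S) by rewrite defined_out.
- case: (sat j Jj) => _ _; rewrite -/(ev j _) => ->.
  by rewrite decode_done //; exact: ex_skip.
- case/andP: lt_P => lt_x lt_y; have := sat j Jj.
  move/assign_decode => -> //; last by rewrite defined_value.
  by rewrite teval_value_decode //; exact: ex_copy.
- case/andP: lt_P => lt_x lt_zs; have := sat j Jj.
  move/assign_decode => -> //; last by rewrite defined_apply_term.
  by rewrite apply_term_decode //; exact: ex_apply.
- case: (sat j Jj) => /(holds_decode _ lt_P (dS j)) Hc [_ _].
  by rewrite -/(ev j _) => ->; rewrite decode_done //; exact: ex_assume.
- case: (sat j Jj) => -[/(holds_decode _ lt_P (dS j)) Hc [_ _]];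
    rewrite -/(ev j _) => ->.
    by rewrite decode_done //; exact: ex_assert.
  by rewrite decode_fail //; exact: ex_assert_fail.
- case/andP: lt_P => lt_P1 lt_P2.
  have [simple1 simple2] :
      (simple_body P1 \/
         simple_loops P1 /\ (forall i, i < nu bound_var -> J i)) /\
      (simple_body P2 \/
         simple_loops P2 /\ (forall i, i < nu bound_var -> J i)).
    by case: simpleP => [/andP[]|[/andP[]]]; auto.
  have ev1 i : J i -> ev i (out P1 S) = ev j (out P1 S).
    move=> Ji; rewrite /ev !teval_out -!/(ev _ S) evS //.
    by rewrite (teval_quote _ _ (nui j)).
  have d1 i : defined (nui i) (out P1 S) by rewrite defined_out.
  have sat1 i : J i -> qsat rho (nui i) true (enc_stmt n P1 S).
    by move/sat => [[]].
  have sat2 i : J i -> qsat rho (nui i) true (enc_stmt n P2 (out P1 S)).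
    by move/sat => [[]].
  have [_ /(_ ne) run1] := IH1 _ _ _ lt_P1 Jj simple1 evS dS sat1.
  have [fail2 run2] := IH2 _ _ _ lt_P2 Jj simple2 ev1 d1 sat2.
  case: (sat j Jj) => _ [_ _]; rewrite -!/(ev j _) => ->.
  have [Ef|ne1] := classic (ev j (out P1 S) = rho 1).
    rewrite decode_fail ?fail2 //; apply: ex_seq_fail.
    by rewrite decode_fail in run1.
  by apply: ex_seq (run2 ne1); rewrite -decode_done.
- case/and3P: lt_P => lt_c lt_P1 lt_P2.
  case: simpleP => [//|[/andP[simple1 simple2] all_J]].
  (* Which disjunct holds might depend on the index. But the condition reads only [S], which is
     constant on [J], so the same branch is constrained throughout [J]. *)
  have holds_j i : J i -> decode_state (ev i S) = decode_state (ev j S).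
    by move/evS->.
  have [Hc|Hc] := classic (holds (decode_state (ev j S)) c).
    have sat1 i : J i -> qsat rho (nui i) true (enc_stmt n P1 S) /\
        ev i (out (SIf c P1 P2) S) = ev i (out P1 S).
      move=> Ji; case: (sat i Ji) => [[_ [? []]] //|].
      by case=> /(holds_decode _ lt_c (dS i)); rewrite holds_j.
    have [_ /(_ ne) run1] := IH1 _ _ _ lt_P1 Jj (or_intror (conj simple1 all_J))
      evS dS (fun i Ji => proj1 (sat1 i Ji)).
    by rewrite (proj2 (sat1 j Jj)); apply: ex_if_true.
  have sat2 i : J i -> qsat rho (nui i) true (enc_stmt n P2 S) /\
      ev i (out (SIf c P1 P2) S) = ev i (out P2 S).
    move=> Ji; case: (sat i Ji) => [|[_ [? []]] //].
    by case=> /(holds_decode _ lt_c (dS i)); rewrite holds_j.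
  have [_ /(_ ne) run2] := IH2 _ _ _ lt_P2 Jj (or_intror (conj simple2 all_J))
    evS dS (fun i Ji => proj1 (sat2 i Ji)).
  by rewrite (proj2 (sat2 j Jj)); apply: ex_if_false.
- case/andP: lt_P => lt_c lt_P1.
  case: simpleP => [//|[simple1 all_J]]; set P := SWhile c P1 in sat *.
  pose lp k := ev j (loop_state P S (AConst (Posz k))).
  have dloop i a : (0 <= aeval (nui i) a)%R ->
      defined (nui i) (loop_state P S a).
    by rewrite defined_loop_state dS.
  have ev_loop i a k : J i -> aeval (nui i) a = Posz k ->
      ev i (loop_state P S a) = lp k.
    move=> Ji Ea; rewrite /lp /ev !teval_loop_state -!/(ev _ S) evS //.
    by rewrite (teval_quote _ (nui i) (nui j)) /= Ea.
  (* The execution is built backwards from a continuation: whatever the loop yields from its state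
     after [k] steps, it also yields from [S]. A step that changes nothing is skipped, any other
     becomes an iteration. *)
  have steps k : k <= nu bound_var -> forall o,
      (lp k = rho 1 -> o = Fail decode_model) ->
      (lp k <> rho 1 -> exec P (decode_state (lp k)) o) ->
      exec P (decode_state (ev j S)) o.
    elim: k => [_ o _|k IHk lt_k o Hfail Hexec].
      have -> : lp 0 = ev j S by case: (sat j Jj) => [[[_ _ ?] _] _].
      exact.
    have Jk := all_J k lt_k.
    have dS_k i : defined (nui i) (loop_state P S (AVar index_var)).
      by apply: dloop; rewrite /=.
    have Ek : ev k (loop_state P S (AVar index_var)) = lp k.
      by apply: ev_loop; rewrite /= /upd.
    have Ek1 :
        ev k (loop_state P S (AAdd (AVar index_var) (AConst 1))) = lp k.+1.
      apply: ev_loop => //; rewrite /= /upd /=; exact: (congr1 Posz (addn1 k)).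
    case: (sat k Jk) => _ [_ [[_ _]|[Hc [satB [_ _]]]]];
      rewrite -!/(ev k _) Ek1.
      by rewrite Ek => eq_lp; apply: IHk; rewrite -?eq_lp // ltnW.
    move: Hc; move/(holds_decode _ lt_c (dS_k k)); rewrite Ek => Hc eq_lp.
    (* The state before the step varies with the index, so the hypothesis for the body is applied to
       the single index [k]. *)
    have [] := IH1 _ (eq k) k lt_P1 erefl (or_introl simple1) _ dS_k _.
    - by move=> i <-.
    - by move=> i <-.
    rewrite Ek -eq_lp => fail_lp run_lp.
    apply: IHk; first exact: ltnW.
      by move/fail_lp; exact: Hfail.
    move=> ne_k; have [Ef|ne_k1] := classic (lp k.+1 = rho 1).
      rewrite (Hfail Ef); apply: ex_while_fail => //.
      by have := run_lp ne_k; rewrite decode_fail.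
    apply: ex_while_step (Hexec ne_k1) => //.
    by have := run_lp ne_k; rewrite decode_done.
  have dm i : defined (nui i) (loop_state P S (AVar bound_var)).
    by apply: dloop; rewrite /=.
  have Em : ev j (loop_state P S (AVar bound_var)) = lp (nu bound_var).
    by apply: ev_loop; rewrite //= /upd.
  case: (sat j Jj) => -[_ [_ _ Eout]] [exit _].
  move: Eout; rewrite -!/(ev j _) => ->; rewrite Em.
  apply: (steps (nu bound_var)) => //; first exact: decode_fail.
  move=> ne_m; rewrite decode_done //; case: exit => [[_ _]|].
    by rewrite -/(ev j _) Em.
  move/(holds_decode false lt_c (dm j)); rewrite Em; exact: ex_while_exit.
Qed.

Lemma enc_sound P : stmt_below n P -> simple_loops P -> 0 < nu bound_var ->
  rho 2 <> rho 1 -> teval rho nu (out P start) = rho 1 ->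
  (forall i, i < nu bound_var -> qsat rho (nui i) true (enc_stmt n P start)) ->
  reaches_fail P.
Proof.
move=> lt_P simpleP m_gt0 ne Eout sat.
have [_ /(_ ne)] := @runs_enc_stmt P start (fun i => i < nu bound_var) 0 lt_P
  m_gt0 (or_intror (conj simpleP (fun i Hi => Hi))) (fun _ _ => erefl)
  (fun _ => isT) sat.
have /decode_fail -> : ev 0 (out P start) = rho 1.
  by rewrite -Eout /ev !teval_out (teval_quote _ nu (nui 0)).
by exists decode_model, (decode_state (rho 2)).
Qed.

End Soundness.

(** * Completeness *)

Lemma nat_tree_inj : injective nat_tree.
Proof. by move=> m n /(congr1 tree_size); rewrite !tree_size_nat_tree. Qed.

Lemma seq_nat_tree_inj : injective (fun zs => seq_tree (map nat_tree zs)).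
Proof. by elim=> [|z zs IHzs] [|z' zs'] //= [/nat_tree_inj-> /IHzs->]. Qed.

Lemma cond_tree_inj : injective cond_tree.
Proof.
elim=> [x y|c1 IH1 c2 IH2|c1 IH1] [x' y'|c1' c2'|c1'] //= [].
- by move=> /nat_tree_inj-> /nat_tree_inj->.
- by move=> /IH1-> /IH2->.
- by move=> /IH1->.
Qed.

Lemma stmt_tree_inj : injective stmt_tree.
Proof.
elim=> [|x y|x f zs|c|c|P1 IH1 P2 IH2|c P1 IH1 P2 IH2|c P1 IH1]
  [|x' y'|x' f' zs'|c'|c'|P1' P2'|c' P1' P2'|c' P1'] //= [].
- by move=> /nat_tree_inj-> /nat_tree_inj->.
- by move=> /nat_tree_inj-> /nat_tree_inj-> /seq_nat_tree_inj->.
- by move=> /cond_tree_inj->.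
- by move=> /cond_tree_inj->.
- by move=> /IH1-> /IH2->.
- by move=> /cond_tree_inj-> /IH1-> /IH2->.
- by move=> /cond_tree_inj-> /IH1->.
Qed.

Lemma exec_det (M : model) P (s : state M) o o' :
  exec P s o -> exec P s o' -> o = o'.
Proof.
move=> Hexec; elim: Hexec o' => {P s o}; intros;
  match goal with H : exec _ _ _ |- _ = _ => inversion H; subst end;
  repeat match goal with
  | IH : forall o, exec ?P ?s o -> _ = o, H : exec ?P ?s _ |- _ =>
      move: (IH _ H) => {H}; (case=> ? || move=> ?); subst
  end; by [].
Qed.

(** * A model made of values, outcomes and codes *)

Section Completeness.
Variables (M : model) (s0 : state M).

Inductive euniv : Type :=
| EVal of univ M
| EOut of outcome M
| ETree of tree.

Definition decode_stmt (t : tree) : stmt :=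
  epsilon (inhabits SSkip) (fun P => stmt_tree P = t).

(** A program that blocks or diverges from a state gets an arbitrary outcome there; constraints are
    only proved at states from which an execution ends, and at failure. *)
Definition run (P : stmt) (o : outcome M) : outcome M :=
  if o is Done s then epsilon (inhabits (Fail M)) (exec P s) else Fail M.

(** Stationary after exit or failure. These are the unchanged steps that the formula permits, so the
    bound may exceed the number of iterations. *)
Definition iteration (c : cond) (P : stmt) (o : outcome M) : outcome M :=
  match o with
  | Done s => if excluded_middle_informative (holds s c) then run P o else o
  | Fail => o
  end.

Definition run_loop (P : stmt) (k : nat) (o : outcome M) : outcome M :=
  if P is SWhile c P1 then iter k (iteration c P1) o else o.

(** Here and below, [s0 0] is a default value, which exists because the execution has an initial
    state. *)
Definition lookup (o : outcome M) (x : var) : univ M :=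
  if o is Done s then s x else s0 0.

Definition unval (u : euniv) : univ M := if u is EVal v then v else s0 0.

(** Pairing of codes and outcomes of programs share the binary function 0 and are told apart by the
    kind of the first argument. [tree_size] recovers a number from its code. *)
Definition einterp (g : fname) (us : seq euniv) : euniv :=
  match g, us with
  | 0, [:: ETree t] => ETree (Node Leaf t)
  | 0, [:: ETree l; ETree r] => ETree (Node l r)
  | 0, [:: EOut o; ETree t] => EOut (run (decode_stmt t) o)
  | 0, [:: EOut o; ETree t; _] => EVal (lookup o (tree_size t))
  | 0, [:: EOut o; ETree t; ETree k; _] =>
      EOut (run_loop (decode_stmt t) (tree_size k) o)
  | f.+1, _ => EVal (interp f (map unval us))
  | _, _ => EVal (s0 0)
  end.

Definition emodel : model := Model einterp.

Definition erho (x : nat) : univ emodel :=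
  match x with
  | 0 => ETree Leaf
  | 1 => EOut (Fail M)
  | 2 => EOut (Done s0)
  | f.+3 => EVal (interp f [::])
  end.

Lemma decode_stmt_tree P : decode_stmt (stmt_tree P) = P.
Proof.
apply: stmt_tree_inj.
exact: (epsilon_spec (inhabits SSkip) (fun Q => stmt_tree Q = stmt_tree P)
  (ex_intro _ P erefl)).
Qed.

Lemma run_exec P s o : exec P s o -> run P (Done s) = o.
Proof.
move=> Hexec; symmetry; apply: (exec_det Hexec).
exact: (epsilon_spec (inhabits (Fail M)) (exec P s) (ex_intro _ o Hexec)).
Qed.

Lemma teval_quote_tree nu t : teval erho nu (quote t) = ETree t.
Proof. by elim: t => //= l -> r ->. Qed.

Lemma teval_idx nu a : teval erho nu (idx a) = ETree (nat_tree `|aeval nu a|%N).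
Proof. by rewrite /=; elim: `|aeval nu a|%N => //= n ->. Qed.

Lemma teval_value_out nu S o x :
  teval erho nu S = EOut o -> teval erho nu (value S x) = EVal (lookup o x).
Proof.
by move=> ES; rewrite teval_value ES teval_idx /= tree_size_nat_tree.
Qed.

Lemma teval_out_run nu S o P :
  teval erho nu S = EOut o -> teval erho nu (out P S) = EOut (run P o).
Proof.
by move=> ES; rewrite teval_out ES teval_quote_tree /= decode_stmt_tree.
Qed.

Lemma teval_loop_run nu S o c P a :
  teval erho nu S = EOut o ->
  teval erho nu (loop_state (SWhile c P) S a) =
    EOut (iter `|aeval nu a|%N (iteration c P) o).
Proof.
move=> ES; rewrite teval_loop_state ES teval_idx teval_quote_tree.
by set t := stmt_tree _; rewrite /= tree_size_nat_tree /t decode_stmt_tree.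
Qed.

Lemma teval_apply_term nu S s f zs :
  teval erho nu S = EOut (Done s) ->
  teval erho nu (apply_term S f zs) = EVal (interp f (map s zs)).
Proof.
move=> ES; case: zs => [//|z1 [|z2 zs]];
  rewrite [LHS]/= !(teval_value_out _ ES) //=.
congr (EVal (interp _ [:: _, _ & _])); rewrite -map_comp -map_comp.
by apply: eq_map => z; rewrite /= (teval_value_out _ ES).
Qed.

Lemma qsat_holds nu b n c S s :
  teval erho nu S = EOut (Done s) -> defined nu S -> cond_below n c ->
  (if b then holds s c else ~ holds s c) -> qsat erho nu b (enc_cond c S).
Proof.
move=> ES dS lt_c; rewrite (@qsat_enc_cond _ erho M EVal s nu n) //.
  by move=> x y [].
by move=> x _; rewrite (teval_value_out _ ES).
Qed.

Lemma qsat_assign nu n S O s x t v :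
  defined nu S -> defined nu O -> defined nu t ->
  teval erho nu S = EOut (Done s) ->
  teval erho nu O = EOut (Done (upd s x v)) ->
  teval erho nu t = EVal v ->
  qsat erho nu true (assign n S O x t).
Proof.
move=> dS dO dt ES EO Et; split; first by split=> //; rewrite EO.
split.
  by split; rewrite ?defined_value // (teval_value_out _ EO) /upd /= eqxx.
apply/qsat_frame => // z _ /eqP ne.
by rewrite (teval_value_out _ EO) (teval_value_out _ ES) /= /upd (negbTE ne).
Qed.

Lemma qsat_enc_failed nu n P S :
  defined nu S -> teval erho nu S = EOut (Fail M) ->
  qsat erho nu true (enc_stmt n P S).
Proof.
move=> dS ES; case: P => *; cbn [enc_stmt];
  apply/qsat_unless_failed; rewrite ?defined_out //.
all: by left; rewrite ES (teval_out_run _ ES).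
Qed.

(** Allowing all bounds from [m] on makes this monotone in [m], so the bounds of subprograms combine
    by maxima. As [nu] is otherwise arbitrary, the constraint holds at every index. *)
Definition encodes (m : nat) (P : stmt) (s : state M) : Prop :=
  forall nu n S, m <= nu bound_var -> defined nu S -> stmt_below n P ->
    teval erho nu S = EOut (Done s) -> qsat erho nu true (enc_stmt n P S).

Lemma encodes_leq m m' P s : m <= m' -> encodes m P s -> encodes m' P s.
Proof.
by move=> le_m enc_m nu n S le_m'; apply: enc_m; apply: leq_trans le_m'.
Qed.

Lemma iteration_true c P s :
  holds s c -> iteration c P (Done s) = run P (Done s).
Proof. by rewrite /iteration; case: excluded_middle_informative. Qed.

Lemma iteration_false c P s : ~ holds s c -> iteration c P (Done s) = Done s.
Proof. by rewrite /iteration; case: excluded_middle_informative. Qed.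

(** A terminating loop becomes an infinite sequence of outcomes that is eventually constant. The
    number [m] exceeds or equals both the count of iterations and the bounds required by the runs of
    the body. *)
Lemma exec_while_iter c P s o :
  (forall s o, exec P s o -> exists m, encodes m P s) ->
  exec (SWhile c P) s o ->
  let st j := iter j (iteration c P) (Done s) in
  exists m, [/\ forall j, m <= j -> st j = o,
    forall s', o = Done s' -> ~ holds s' c &
    forall j, st j.+1 = st j \/
      exists s', [/\ st j = Done s', holds s' c & encodes m P s']].
Proof.
move=> IH; move EW: (SWhile c P) => W Hexec; elim: Hexec EW => {W s o} //.
- move=> s c' P' Hc [? ?] st; subst c' P'.
  have stE j : st j = Done s.
    by rewrite /st; elim: j => //= j ->; rewrite iteration_false.
  exists 0; split=> [j _|s' [<-]|j] //; by left; rewrite !stE.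
- move=> s s' c' P' o Hc HP _ _ IHW [? ?] st; subst c' P'.
  have [m1 enc1] := IH _ _ HP; have [m2 [lim exit step]] := IHW erefl.
  have stS j : st j.+1 = iter j (iteration c P) (Done s').
    by rewrite /st iterSr iteration_true // (run_exec HP).
  (* [m1] serves the body in the first state; [m2] is shifted by one because the hypothesis counts
     from the second state. *)
  exists (maxn m1 m2.+1); split=> //.
    by case=> [|j] le_j; [lia | rewrite stS lim //; lia].
  case=> [|j].
    by right; exists s; split=> //; apply: encodes_leq enc1; apply: leq_maxl.
  rewrite !stS; case: (step j) => [->|[s1 [-> Hs1 enc2]]]; [by left | right].
  by exists s1; split=> //; apply: encodes_leq enc2; lia.
- move=> s c' P' Hc HP _ [? ?] st; subst c' P'.
  have [m1 enc1] := IH _ _ HP.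
  have stS j : st j.+1 = Fail M.
    rewrite /st; elim: j => [|j IHj]; last by rewrite iterS IHj.
    exact: etrans (iteration_true _ Hc) (run_exec HP).
  (* The successor excludes step 0, at which the loop has not failed yet. *)
  exists m1.+1; split=> //; first by case.
  case=> [|j]; last by left; rewrite !stS.
  by right; exists s; split=> //; apply: encodes_leq enc1.
Qed.

(** Induction on the program rather than on the execution: for a loop, the hypothesis then covers
    the body from every state in which an iteration starts. *)
Lemma exec_encodes P s o : exec P s o -> exists m, encodes m P s.
Proof.
(* [core] concerns the constraint without its guard: the input has not failed, so the second
   disjunct of [unless_failed] is to be proved. *)
pose core P s o q := exists m, forall nu n S, m <= nu bound_var ->
  defined nu S -> defined nu (out P S) -> stmt_below n P ->
  teval erho nu S = EOut (Done s) -> teval erho nu (out P S) = EOut o ->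
  qsat erho nu true (q n S).
have encodes_core P' s' o' q : exec P' s' o' ->
    (forall n S, enc_stmt n P' S = unless_failed S (out P' S) (q n S)) ->
    core P' s' o' q -> exists m, encodes m P' s'.
  move=> Hexec Eq [m Hm]; exists m => nu n S le_m dS lt_P ES.
  rewrite Eq; apply/qsat_unless_failed; rewrite ?defined_out //; right.
  rewrite ES; split=> //; apply: Hm; rewrite ?defined_out //.
  by rewrite (teval_out_run _ ES) (run_exec Hexec).
elim: P s o => [|x y|x f zs|c|c|P1 IH1 P2 IH2|c P1 IH1 P2 IH2|c P1 IH1]
  s o Hexec;
  apply: (encodes_core _ _ _ _ Hexec (fun _ _ => erefl)).
- inversion Hexec; subst; exists 0 => nu n S _ dS dO _ ES EO.
  by split; rewrite // ES EO.
- inversion Hexec; subst; exists 0 => nu n S _ dS dO _ ES EO.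
  apply: (qsat_assign _ _ _ _ ES EO); rewrite ?defined_value //.
  by rewrite (teval_value_out _ ES).
- inversion Hexec; subst; exists 0 => nu n S _ dS dO _ ES EO.
  apply: (qsat_assign _ _ _ _ ES EO); rewrite ?defined_apply_term //.
  by rewrite (teval_apply_term _ _ ES).
- inversion Hexec; subst; exists 0 => nu n S _ dS dO lt_c ES EO.
  by split; first exact: (@qsat_holds _ true _ _ _ _ ES dS lt_c);
    split; rewrite // ES EO.
- inversion Hexec; subst; exists 0 => nu n S _ dS dO lt_c ES EO; [left|right].
    by split; first exact: (@qsat_holds _ true _ _ _ _ ES dS lt_c);
    split; rewrite // ES EO.
  by split; [exact: (@qsat_holds _ false _ _ _ _ ES dS lt_c) | split].
- inversion Hexec; subst;
    match goal with H : exec P1 _ _ |- _ => rename H into run1 end.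
    match goal with H : exec P2 _ _ |- _ => rename H into run2 end.
    have [[m1 enc1] [m2 enc2]] := (IH1 _ _ run1, IH2 _ _ run2).
    exists (maxn m1 m2) => nu n S; rewrite geq_max => /andP[le_m1 le_m2].
    move=> dS dO /andP[lt1 lt2] ES EO.
    have E1 := teval_out_run P1 ES; have E2 := teval_out_run P2 E1.
    rewrite (run_exec run1) in E1 E2; rewrite (run_exec run2) in E2.
    split; last by split; rewrite ?defined_out // EO E2.
    by split; [apply: enc1 | apply: enc2; rewrite ?defined_out].
  have [m1 enc1] := IH1 _ _ run1.
  exists m1 => nu n S le_m1 dS dO /andP[lt1 lt2] ES EO.
  have E1 := teval_out_run P1 ES; have E2 := teval_out_run P2 E1.
  rewrite (run_exec run1) in E1 E2.
  split; last by split; rewrite ?defined_out // EO E2.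
  by split; [apply: enc1 | apply: qsat_enc_failed; rewrite ?defined_out].
- inversion Hexec; subst;
    match goal with
    | H : exec P1 _ _ |- _ => rename H into run1
    | H : exec P2 _ _ |- _ => rename H into run2
    end.
    have [m1 enc1] := IH1 _ _ run1.
    exists m1 => nu n S le_m1 dS dO /and3P[lt_c lt1 lt2] ES EO.
    left; split; first exact: (@qsat_holds _ true _ _ _ _ ES dS lt_c).
    split; first exact: enc1.
    by split; rewrite ?defined_out // EO (teval_out_run _ ES) (run_exec run1).
  have [m1 enc1] := IH2 _ _ run2.
  exists m1 => nu n S le_m1 dS dO /and3P[lt_c lt1 lt2] ES EO.
  right; split; first exact: (@qsat_holds _ false _ _ _ _ ES dS lt_c).
  split; first exact: enc1.
  by split; rewrite ?defined_out // EO (teval_out_run _ ES) (run_exec run2).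
have [m [lim exit step]] := exec_while_iter IH1 Hexec.
exists m => nu n S le_m dS dO /andP[lt_c lt1] ES EO.
have d_loop a :
    (0 <= aeval nu a)%R -> defined nu (loop_state (SWhile c P1) S a).
  by rewrite defined_loop_state dS.
have E_loop a := teval_loop_run c P1 a ES.
split; split.
- by split; rewrite ?d_loop // E_loop ES.
- by split; rewrite ?d_loop // EO E_loop /= lim.
- have := E_loop (AVar bound_var); rewrite [`|_|%N]/= lim //.
  case: o exit {Hexec lim EO} => [s'|] exit Em; [right|left].
    apply: (@qsat_holds _ false _ _ _ _ Em _ lt_c); first exact: d_loop.
    exact: exit.
  by split; rewrite ?d_loop.
have Ei := E_loop (AVar index_var).
have := E_loop (AAdd (AVar index_var) (AConst 1)).
have -> : `|aeval nu (AAdd (AVar index_var) (AConst 1))|%N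
            = (nu index_var).+1.
  by rewrite /= addn1.
move=> Ei1; rewrite [`|_|%N]/= in Ei.
case: (step (nu index_var)) => [Eq|[s' [Es' Hs' enc']]]; [left|right].
  by split; rewrite ?d_loop // Ei Ei1 Eq.
rewrite Es' in Ei; split.
  by apply: (qsat_holds Ei _ lt_c); rewrite ?d_loop.
split; first by apply: enc'; rewrite ?d_loop.
split; rewrite ?defined_out ?d_loop //.
by rewrite (teval_out_run _ Ei) Ei1 iterS Es' iteration_true.
Qed.

End Completeness.

Lemma enc_complete P : reaches_fail P -> satisfiable (enc P).
Proof.
case=> M [s Hexec]; have [m enc_m] := exec_encodes s Hexec.
(* The successor meets the demand that the bound be at least 1. *)
pose nu x := if x == bound_var then m.+1 else 0.
have dS nu' : defined nu' (out P start) by rewrite defined_out.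
have ES nu' : teval (erho s) nu' start = EOut (Done s) by [].
exists nu, (emodel s), (erho s); split.
  split; first by [].
  split; first by split.
  by split; rewrite // (teval_out_run P (ES nu)) (run_exec Hexec).
move=> k _; apply: enc_m => //; exact: stmt_below_tree_size.
Qed.

(** * Effectiveness *)

Transparent value out loop_state.

(* [t_foo] computes the code of [foo] from the codes of its arguments. *)
Definition t_eq s t := con 0 [:: s; t].
Definition t_le s t := con 1 [:: s; t].
Definition t_not q := con 2 [:: q].
Definition t_and q r := con 3 [:: q; r].
Definition t_or q r := con 4 [:: q; r].
Definition t_const n := con 0 [:: Node Leaf n].
Definition t_origin := term_tree origin.
Definition t_failed := term_tree failed.
Definition t_idx a := con 1 [:: Leaf; Leaf; a; t_origin].
Definition t_num n := t_idx (t_const n).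
Definition t_quote t :=
  treerec (fun=> t_origin)
    (fun w => con 2 [:: Leaf; lchild (rchild w); rchild (rchild w); Leaf])
    Leaf t.
Definition t_value s x := con 2 [:: Leaf; s; t_num x; seq_tree [:: t_origin]].
Definition t_out p s := con 2 [:: Leaf; s; t_quote p; Leaf].
Definition t_loop_state p s a :=
  con 2 [:: Leaf; s; t_quote p; seq_tree [:: t_idx a; t_origin]].

Definition t_values s zs :=
  treerec (fun=> Leaf)
    (fun w => Node (t_value (lchild (lchild w)) (lchild (rchild (lchild w))))
                   (rchild (rchild w)))
    s zs.
Definition t_apply_term s f zs :=
  let g := Node Leaf f in
  let vs := t_values s zs in
  ite zs (con 0 [:: Node Leaf (Node Leaf g)])
    (ite (rchild zs)
       (con 1 [:: g; Leaf; t_const (nat_tree 1); lchild vs])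
       (con 2 [:: g; lchild vs; lchild (rchild vs); rchild (rchild vs)])).

Definition t_frame n s o x :=
  treerec (fun=> t_le (t_const Leaf) (t_const Leaf))
    (fun w =>
       let a := lchild (lchild w) in
       let z := rchild (rchild (lchild w)) in
       let s := lchild a in
       let o := lchild (rchild a) in
       let x := rchild (rchild a) in
       t_and (t_or (t_and (t_le (t_const z) (t_const x))
                          (t_le (t_const x) (t_const z)))
                (t_eq (t_value o z) (t_value s z)))
             (rchild (rchild w)))
    (Node s (Node o x)) n.
Definition t_assign n s o x t :=
  t_and (t_not (t_eq o t_failed))
        (t_and (t_eq (t_value o x) t) (t_frame n s o x)).
Definition t_unless_failed s o q :=
  t_or (t_and (t_eq s t_failed) (t_eq o t_failed))
       (t_and (t_not (t_eq s t_failed)) q).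

Definition tag x := lchild x.
Definition arg1 x := lchild (rchild x).
Definition arg2 x := lchild (rchild (rchild x)).
Definition arg3 x := lchild (rchild (rchild (rchild x))).

(* Applied to [Node c s], where c is the code of a condition. *)
Definition cond_call z := tag (lchild z).
Definition cond_base z :=
  t_eq (t_value (rchild z) (arg1 (lchild z)))
       (t_value (rchild z) (arg2 (lchild z))).
Definition cond_sub1 z := Node (arg1 (lchild z)) (rchild z).
Definition cond_sub2 z := Node (arg2 (lchild z)) (rchild z).
Definition cond_combine w :=
  ite (rchild (tag (lchild (lchild w))))
    (t_and (lchild (rchild w)) (rchild (rchild w)))
    (t_not (lchild (rchild w))).
Definition code_size z := tree_size (lchild z).
Definition t_cond :=
  dc cond_call cond_base cond_sub1 cond_sub2 cond_combine code_size.

(* Applied to [Node p (Node n s)], where p is the code of a statement. *)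
Definition stmt_call z := iter 4 rchild (tag (lchild z)).
Definition stmt_base z :=
  let p := lchild z in
  let n := lchild (rchild z) in
  let s := rchild (rchild z) in
  let o := t_out p s in
  let k := tag p in
  t_unless_failed s o
    (ite k (t_eq o s)
    (ite (rchild k) (t_assign n s o (arg1 p) (t_value s (arg2 p)))
    (ite (rchild (rchild k))
       (t_assign n s o (arg1 p) (t_apply_term s (arg2 p) (arg3 p)))
    (ite (rchild (rchild (rchild k)))
       (t_and (t_cond (Node (arg1 p) s)) (t_eq o s))
       (t_or (t_and (t_cond (Node (arg1 p) s)) (t_eq o s))
             (t_and (t_not (t_cond (Node (arg1 p) s))) (t_eq o t_failed))))))).
Definition t_index := arith_tree (AVar index_var).
Definition t_next_index := arith_tree (AAdd (AVar index_var) (AConst 1)).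
Definition t_bound := arith_tree (AVar bound_var).
(** [k] is the remainder of the unary tag: 0 for a sequence, 1 for a conditional, 2 for a loop. The
    body of a loop is encoded at the state of the current index. The scheme always makes two calls;
    for a loop the second falls on the code [Leaf] and ends at once. *)
Definition stmt_sub1 z :=
  let p := lchild z in
  let n := lchild (rchild z) in
  let s := rchild (rchild z) in
  let k := rchild (stmt_call z) in
  ite k (Node (arg1 p) (Node n s))
    (Node (arg2 p) (Node n (ite (rchild k) s (t_loop_state p s t_index)))).
Definition stmt_sub2 z :=
  let p := lchild z in
  let n := lchild (rchild z) in
  let s := rchild (rchild z) in
  let k := rchild (stmt_call z) in
  ite k (Node (arg2 p) (Node n (t_out (arg1 p) s))) (Node (arg3 p) (Node n s)).
Definition stmt_combine w :=
  let z := lchild w in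
  let q1 := lchild (rchild w) in
  let q2 := rchild (rchild w) in
  let p := lchild z in
  let s := rchild (rchild z) in
  let o := t_out p s in
  let k := rchild (stmt_call z) in
  let c t := t_cond (Node (arg1 p) t) in
  let si := t_loop_state p s t_index in
  let si1 := t_loop_state p s t_next_index in
  let sm := t_loop_state p s t_bound in
  t_unless_failed s o
    (ite k (t_and (t_and q1 q2) (t_eq o (t_out (arg2 p) (t_out (arg1 p) s))))
    (ite (rchild k)
       (t_or (t_and (c s) (t_and q1 (t_eq o (t_out (arg2 p) s))))
             (t_and (t_not (c s)) (t_and q2 (t_eq o (t_out (arg3 p) s)))))
       (t_and (t_and (t_eq (t_loop_state p s (t_const Leaf)) s) (t_eq o sm))
          (t_and (t_or (t_eq sm t_failed) (t_not (c sm)))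
             (t_or (t_eq si1 si)
                (t_and (c si) (t_and q1 (t_eq si1 (t_out (arg2 p) si))))))))).
Definition t_stmt :=
  dc stmt_call stmt_base stmt_sub1 stmt_sub2 stmt_combine code_size.

Definition t_add m n :=
  treerec id (fun w => Node Leaf (rchild (rchild w))) m n.
Definition t_size t :=
  treerec id
    (fun w => Node Leaf (t_add (lchild (rchild w)) (rchild (rchild w))))
    Leaf t.
Definition t_enc p :=
  let s := term_tree start in
  con 1 [:: con 0 [:: t_and (t_le (t_const (nat_tree 1)) t_bound)
                       (t_and (t_not (t_eq s t_failed))
                              (t_eq (t_out p s) t_failed))];
            con 3 [:: nat_tree index_var; nat_tree bound_var;
                      t_stmt (Node p (Node (t_size p) s))]].

(** * Recursiveness of the encoder *)

Lemma code_size_cond_sub z : cond_call z <> Leaf ->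
  code_size (cond_sub1 z) < code_size z /\
  code_size (cond_sub2 z) < code_size z.
Proof.
rewrite /cond_call /code_size /cond_sub1 /cond_sub2 /tag /arg1 /arg2 /=.
by case: (lchild z) => //= l [|a [|b r]] //= _; split; lia.
Qed.

(** A nonzero tag makes the code a node, whose arguments are proper subtrees or [Leaf]. This covers
    all trees, even those that code no statement, as the recursion scheme demands. *)
Lemma code_size_stmt_sub z : stmt_call z <> Leaf ->
  code_size (stmt_sub1 z) < code_size z /\
  code_size (stmt_sub2 z) < code_size z.
Proof.
rewrite /stmt_sub1 /stmt_sub2; case: (rchild (stmt_call z)) => [|l r].
  rewrite /stmt_call /code_size /tag /arg1 /arg2 /arg3 /=.
  by case: (lchild z) => //= k [|a [|b x]] //= _; split; lia.
rewrite /stmt_call /code_size /tag /arg1 /arg2 /arg3 /=.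
by case: (lchild z) => //= k [|a [|b [|d x]]] //= _; split; lia.
Qed.

Lemma rec_t_cond : recursive t_cond.
Proof.
by apply: rec_dc; try by [rec_tac | move=> z /code_size_cond_sub[]].
Qed.

Lemma rec_t_stmt : recursive t_stmt.
Proof.
have Hc := rec_t_cond.
by apply: rec_dc; try by [rec_tac | move=> z /code_size_stmt_sub[]].
Qed.

Lemma rec_t_enc : recursive t_enc.
Proof. have Hs := rec_t_stmt; rec_tac. Qed.

(** * The computed trees are the codes of the encoding *)

Lemma t_quoteE t : t_quote t = term_tree (quote t).
Proof. by elim: t => //= l <- r <-. Qed.

Lemma t_outE P S : t_out (stmt_tree P) (term_tree S) = term_tree (out P S).
Proof. by rewrite /t_out t_quoteE. Qed.

Lemma t_loop_stateE P S a :
  t_loop_state (stmt_tree P) (term_tree S) (arith_tree a) =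
    term_tree (loop_state P S a).
Proof. by rewrite /t_loop_state t_quoteE. Qed.

Lemma t_apply_termE S f zs :
  t_apply_term (term_tree S) (nat_tree f) (seq_tree (map nat_tree zs)) =
    term_tree (apply_term S f zs).
Proof.
have valuesE ys : t_values (term_tree S) (seq_tree (map nat_tree ys)) =
    seq_tree (map term_tree (map (value S) ys)).
  by elim: ys => //= y ys <-.
rewrite /t_apply_term valuesE.
by case: zs => [|z1 [|z2 zs]].
Qed.

Lemma t_frameE n S O x :
  t_frame (nat_tree n) (term_tree S) (term_tree O) (nat_tree x) =
    qform_tree (frame n S O x).
Proof. by rewrite /t_frame; elim: n => //= n ->. Qed.

Lemma t_assignE n S O x t :
  t_assign (nat_tree n) (term_tree S) (term_tree O) (nat_tree x) (term_tree t) =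
    qform_tree (assign n S O x t).
Proof. by rewrite /t_assign t_frameE. Qed.

Lemma t_condE c S :
  t_cond (Node (cond_tree c) (term_tree S)) = qform_tree (enc_cond c S).
Proof.
have sub1 z Hz := proj1 (@code_size_cond_sub z Hz).
have sub2 z Hz := proj2 (@code_size_cond_sub z Hz).
elim: c => [x y|c1 IH1 c2 IH2|c1 IH1]; rewrite /t_cond dcE // -/t_cond /=.
- by rewrite /cond_combine /cond_sub1 /cond_sub2 /= IH1 IH2.
- by rewrite /cond_combine /cond_sub1 /= IH1.
Qed.

Lemma t_stmtE n P S :
  t_stmt (Node (stmt_tree P) (Node (nat_tree n) (term_tree S))) =
    qform_tree (enc_stmt n P S).
Proof.
have sub1 z Hz := proj1 (@code_size_stmt_sub z Hz).
have sub2 z Hz := proj2 (@code_size_stmt_sub z Hz).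
pose node P S := Node (stmt_tree P) (Node (nat_tree n) (term_tree S)).
have callE P' S' : stmt_call (node P' S') <> Leaf ->
    t_stmt (node P' S') = stmt_combine (Node (node P' S')
      (Node (t_stmt (stmt_sub1 (node P' S')))
            (t_stmt (stmt_sub2 (node P' S'))))).
  by rewrite {1}/t_stmt dcE //; case: (stmt_call _).
have baseE P' S' : stmt_call (node P' S') = Leaf ->
    t_stmt (node P' S') = stmt_base (node P' S').
  by move=> E; rewrite {1}/t_stmt dcE // E.
elim: P S => [|x y|x f zs|c|c|P1 IH1 P2 IH2|c P1 IH1 P2 IH2|c P1 IH1] S.
- by rewrite (baseE SSkip S erefl).
- rewrite (baseE (SCopy x y) S erefl) /stmt_base; cbv zeta.
  by rewrite (t_outE (SCopy x y)) (t_assignE n S _ x (value S y)).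
- rewrite (baseE (SApply x f zs) S erefl) /stmt_base; cbv zeta.
  rewrite (t_outE (SApply x f zs)) (t_apply_termE S f zs).
  by rewrite (t_assignE n S _ x (apply_term S f zs)).
- rewrite (baseE (SAssume c) S erefl) /stmt_base; cbv zeta.
  by rewrite (t_outE (SAssume c)) (t_condE c S).
- rewrite (baseE (SAssert c) S erefl) /stmt_base; cbv zeta.
  by rewrite (t_outE (SAssert c)) (t_condE c S).
- rewrite callE // -[stmt_sub1 _]/(node P1 S).
  have -> : stmt_sub2 (node (SSeq P1 P2) S) = node P2 (out P1 S).
    by rewrite /node -t_outE.
  rewrite IH1 IH2 /stmt_combine; cbv zeta.
  by rewrite (t_outE (SSeq P1 P2)) (t_outE P1 S) (t_outE P2 (out P1 S)).
- rewrite callE // -[stmt_sub1 _]/(node P1 S) -[stmt_sub2 _]/(node P2 S).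
  rewrite IH1 IH2 /stmt_combine; cbv zeta.
  by rewrite (t_outE (SIf c P1 P2)) (t_outE P1 S) (t_outE P2 S) (t_condE c S).
set Si := loop_state (SWhile c P1) S (AVar index_var).
have -> : t_stmt (node (SWhile c P1) S) = stmt_combine
    (Node (node (SWhile c P1) S)
       (Node (t_stmt (node P1 Si)) (t_stmt (stmt_sub2 (node (SWhile c P1) S))))).
  by rewrite callE // /node /Si -t_loop_stateE.
rewrite IH1 /stmt_combine; cbv zeta.
have loopE := t_loop_stateE (SWhile c P1) S.
rewrite (t_outE (SWhile c P1)) (loopE (AVar index_var)) (loopE (AVar bound_var)).
rewrite (loopE (AAdd (AVar index_var) (AConst 1))) (loopE (AConst 0)).
by rewrite !(t_condE c) (t_outE P1 Si).
Qed.

Lemma t_addE m n : t_add (nat_tree m) (nat_tree n) = nat_tree (n + m).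
Proof. by rewrite /t_add; elim: n => //= n ->. Qed.

Lemma t_sizeE t : t_size t = nat_tree (tree_size t).
Proof. by rewrite /t_size; elim: t => //= l -> r ->; rewrite t_addE addnC. Qed.

Lemma t_encE P : t_enc (stmt_tree P) = formula_tree (enc P).
Proof. by rewrite /t_enc t_sizeE t_stmtE t_outE. Qed.

Theorem theorem8 :
  exists enc : stmt -> formula,
    effective enc /\
    forall P : stmt, simple_loops P ->
      (satisfiable (enc P) <-> reaches_fail P) /\
      (correct P <-> ~ satisfiable (enc P)).
Proof.
exists enc; split; first by exists t_enc; [exact: rec_t_enc | exact: t_encE].
move=> P simpleP; have satE : satisfiable (enc P) <-> reaches_fail P.
  split; last exact: enc_complete.
  case=> nu [M [rho [[m_gt0 [[_ _ ne] [_ _ Eout]]] sat]]].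
  exact: enc_sound (stmt_below_tree_size (leqnn _)) simpleP m_gt0 ne Eout sat.
split=> //; rewrite satE; split=> [Pcorrect [M [s]]|nfail M s Hexec].
  exact: Pcorrect.
by apply: nfail; exists M, s.
Qed.
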